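(* Let $L$ be a finite-dimensional (left) Leibniz algebra over an arbitrary field and let $U$ be a subnormal subalgebra of $L$. Then the nilpotent residual $U_{\mathfrak N}=\bigcap_{r\ge 1}U^r$ of $U$ is a (two-sided) ideal of $L$.
   Context: A (left) Leibniz algebra over a field $F$ is an $F$-vector space $L$ with a bilinear product $(a,b)\mapsto ab$ such that every left multiplication $\lambda_a\colon x\mapsto ax$ is a derivation, i.e. $a(xy)=(ax)y+x(ay)$ for all $a,x,y\in L$. A subalgebra is a subspace closed under the product. For subspaces $A,B\subseteq L$, $AB$ denotes the subspace spanned by all products $ab$ with $a\in A$, $b\in B$. An ideal of an algebra $A$ is a two-sided ideal, i.e. a subspace $I$ with $AI\subseteq I$ and $IA\subseteq I$. A subalgebra $U$ of $L$ is subnormal if there is a finite chain of subalgebras $L=U_0\supset U_1\supset\dots\supset U_n=U$ (with $n\ge 0$) such that each $U_i$ is an ideal of $U_{i-1}$. The powers of a subalgebra $U$ are defined by $U^1=U$ and $U^{k+1}=U\,U^k$. *)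

(* Defs.v *)
From HB Require Import structures.
From mathcomp Require Import all_boot all_order all_algebra.
From mathcomp Require Import boolp.
Set Implicit Arguments.
Unset Strict Implicit.
Unset Printing Implicit Defensive.
Import GRing.Theory.
Local Open Scope ring_scope.

Section BigCap.
Variables (F : fieldType) (L : vectType F).

Fact bigcapv_subproof (T : Type) (P : T -> Prop) (W : T -> {vspace L}) :
  exists N : {vspace L}, forall x, x \in N <-> (forall i, P i -> x \in W i).
Proof.
suff H n : forall V : {vspace L}, (\dim V < n)%N ->
    exists N : {vspace L},
      forall x, x \in N <-> x \in V /\ (forall i, P i -> x \in W i).
  have [N HN] := H (\dim {:L}).+1 fullv (ltnSn _).
  by exists N => x; rewrite HN memvf; split=> [[]|].
elim: n => // n IHn V ltVn.
have [sVW|] := EM (forall i, P i -> (V <= W i)%VS).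
  exists V => x; split=> [Vx|[]//]; split=> // i Pi.
  exact: subvP (sVW i Pi) x Vx.
move=> /existsNP[i /not_implyP[Pi /negP nsVWi]].
have ltd : (\dim (V :&: W i) < \dim V)%N.
  rewrite ltn_neqAle dimvS ?capvSl // andbT; apply: contra nsVWi => eqd.
  by rewrite -[V in (V <= _)%VS](eqP (_ : V :&: W i == V)%VS)
             ?capvSr // eqEdim capvSl (eqP eqd) /=.
have [N HN] := IHn _ (leq_trans ltd ltVn).
exists N => x; rewrite HN memv_cap; split=> [[/andP[Vx _] Wx]|[Vx Wx]] //.
by rewrite Vx Wx.
Qed.

(* Intersection of an arbitrary family of subspaces; its membership is given
   by memv_bigcapv. *)
Definition bigcapv (T : Type) (P : T -> Prop) (W : T -> {vspace L}) :
  {vspace L} := sval (cid (bigcapv_subproof P W)).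

Lemma memv_bigcapv (T : Type) (P : T -> Prop) (W : T -> {vspace L}) x :
  x \in bigcapv P W <-> (forall i, P i -> x \in W i).
Proof. by rewrite /bigcapv; case: cid => N /= HN; apply: HN. Qed.

End BigCap.

Section Leibniz.
Variables (F : fieldType) (L : vectType F) (mul : {bilinear L -> L -> L}).

Definition left_leibniz : Prop :=
  forall a x y, mul a (mul x y) = mul (mul a x) y + mul x (mul a y).

(* The span of all products ab, with a in A and b in B, computed on bases as
   in mathcomp's prodv (which requires an associative product); see mulvP. *)
Definition mulv (A B : {vspace L}) : {vspace L} :=
  <<[seq mul a b | a <- vbasis A, b <- vbasis B]>>%VS.

Lemma memv_mulv (A B : {vspace L}) a b : a \in A -> b \in B -> mul a b \in mulv A B.
Proof.
move=> /coord_vbasis-> /coord_vbasis->.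
rewrite linear_sumlz; apply: memv_suml => i _.
rewrite linear_sumr; apply: memv_suml => j _.
rewrite linearZl_LR linearZr_LR /= !memvZ // memv_span //.
by apply/allpairsP; exists ((vbasis A)`_i, (vbasis B)`_j); rewrite !memt_nth.
Qed.

Lemma mulvP (A B C : {vspace L}) :
  reflect {in A & B, forall a b, mul a b \in C} (mulv A B <= C)%VS.
Proof.
apply: (iffP idP) => [sABC a b Aa Bb | sABC].
  by apply: (subvP sABC); apply: memv_mulv.
apply/span_subvP=> _ /allpairsP[[a b] /= [Aa Bb ->]].
by rewrite sABC ?vbasis_mem.
Qed.

Definition subalgebra (A : {vspace L}) : Prop := (mulv A A <= A)%VS.

Definition ideal_of (A I : {vspace L}) : Prop :=
  [/\ (I <= A)%VS, (mulv A I <= I)%VS & (mulv I A <= I)%VS].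

Definition subnormal (U : {vspace L}) : Prop :=
  exists (n : nat) (V : nat -> {vspace L}),
    [/\ V 0%N = fullv, V n = U,
        (forall i, (i <= n)%N -> subalgebra (V i)) &
        (forall i, (i < n)%N -> ideal_of (V i) (V i.+1))].

(* powv U k is U^k for 1 <= k; powv U 0 is a junk value. *)
Definition powv (U : {vspace L}) (k : nat) : {vspace L} :=
  iter k.-1 (mulv U) U.

Definition nilpotent_residual (U : {vspace L}) : {vspace L} :=
  bigcapv (fun r : nat => (1 <= r)%N) (powv U).

End Leibniz.

(* Main.v *)
Require Import Defs.
From HB Require Import structures.
From mathcomp Require Import all_boot all_order all_algebra.
Set Implicit Arguments.
Unset Strict Implicit.
Unset Printing Implicit Defensive.
Import GRing.Theory.
Local Open Scope ring_scope.

(** Write [T] for the operator [W |-> U W] on subspaces, so that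
    [U^(k+1) = T^k U].  Two facts drive the proof.  By finite dimension the
    powers of [U] become stationary, so [N], the nilpotent residual, is one of
    them and satisfies [U N = N] ([nilpotent_residual_stable]).  Along the
    chain [L = V_0, ..., V_n = U] each application of [T] goes down one step,
    so [T^n L <= U] ([iter_mulv_chain]), and hence [T^(n+k) L <= N] when
    [N = T^k U].

    For [N L], the Leibniz identity says that the left multiplication by [ab]
    is the commutator of those by [a] and [b].  An element of [U^(k+1)]
    therefore acts from the left as a combination of products of [k+1] left
    multiplications by elements of [U] ([mulv_iter_mulv]), and with
    sufficiently many of them [L] is sent into [N].

    For [L N], one shows [V_i N <= N] by descending induction on [i].  Since
    [N = U N], the derivation rule gives
    [V_i N <= (V_i U) N + U (V_i N)].  The ideal [V_(i+1)] of [V_i] contains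
    [U], so [V_i U <= V_(i+1)] and the first term lies in [N] by induction.
    Iterating, [V_i N <= N + T^m (V_i N)] for every [m]
    ([sub_addv_iter_mulv]), and the last term lies in [N] for large [m]. *)

Section Products.
Variables (F : fieldType) (L : vectType F) (mul : {bilinear L -> L -> L}).
Implicit Types A B C N U W X : {vspace L}.

Lemma mulvS A B C D :
  (A <= B)%VS -> (C <= D)%VS -> (mulv mul A C <= mulv mul B D)%VS.
Proof.
move=> /subvP sAB /subvP sCD; apply/mulvP => a c Aa Cc.
by apply: memv_mulv; [apply: sAB | apply: sCD].
Qed.

Lemma iter_mulvS k U A B :
  (A <= B)%VS -> (iter k (mulv mul U) A <= iter k (mulv mul U) B)%VS.
Proof. by move=> sAB; elim: k => //= k; apply: mulvS. Qed.

Lemma mulvDr_sub A B C :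
  (mulv mul A (B + C) <= mulv mul A B + mulv mul A C)%VS.
Proof.
apply/mulvP => a _ Aa /memv_addP[b Bb [c Cc ->]].
by rewrite linearDr /= memv_add ?memv_mulv.
Qed.

(** Substituting the inclusion [X <= N + U X] into itself leaves only a
    remainder with arbitrarily many factors [U]. *)
Lemma sub_addv_iter_mulv U N X k :
  (mulv mul U N <= N)%VS -> (X <= N + mulv mul U X)%VS ->
  (X <= N + iter k (mulv mul U) X)%VS.
Proof.
move=> UN sX; elim: k => [|k IHk] /=; first exact: addvSr.
apply: (subv_trans sX); rewrite subv_add addvSl /=.
apply: (subv_trans (mulvS (subvv U) IHk)).
exact: subv_trans (mulvDr_sub _ _ _) (addvS UN (subvv _)).
Qed.

Lemma iter_mulv_decr U k : subalgebra mul U ->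
  (iter k.+1 (mulv mul U) U <= iter k (mulv mul U) U)%VS.
Proof. by move=> algU; rewrite iterSr; apply: iter_mulvS. Qed.

Lemma iter_mulv_stationary U : subalgebra mul U ->
  exists k, iter k.+1 (mulv mul U) U = iter k (mulv mul U) U.
Proof.
move=> algU; set P := fun k => iter k (mulv mul U) U.
suff H d : forall k, (\dim (P k) < d)%N -> exists k, P k.+1 = P k.
  exact: H (ltnSn (\dim (P 0%N))).
elim: d => // d IHd k ltPd.
have [eqP1|neqP1] := eqVneq (P k.+1) (P k); first by exists k.
apply: (IHd k.+1); apply: leq_trans (ltPd : (_ <= d)%N).
rewrite ltnNge; apply: contra neqP1 => leP1.
by rewrite eqEdim iter_mulv_decr.
Qed.

Lemma nilpotent_residual_stable U : subalgebra mul U ->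
  exists2 k, nilpotent_residual mul U = iter k (mulv mul U) U
           & mulv mul U (nilpotent_residual mul U) = nilpotent_residual mul U.
Proof.
move=> algU; have [k stk] := iter_mulv_stationary algU.
have sub_iter j : (iter k (mulv mul U) U <= iter j (mulv mul U) U)%VS.
  have [lejk|/ltnW lekj] := leqP j k; [rewrite -(subnK lejk)|rewrite -(subnK lekj)].
    elim: (k - j)%N => [|m IHm]; first by rewrite subvv.
    exact: subv_trans (iter_mulv_decr _ algU) IHm.
  by elim: (j - k)%N => //= m IHm; rewrite -{1}stk /=; apply: mulvS.
suff defN : nilpotent_residual mul U = iter k (mulv mul U) U.
  by exists k; rewrite // defN.
apply/vspaceP => x; apply/idP/idP => [/memv_bigcapv Nx | Px].
  exact: (Nx k.+1).
by apply/memv_bigcapv => r _; apply: subvP (sub_iter r.-1) x Px.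
Qed.

(** A left multiplication by an element of [U] maps [V i] into [V i.+1]
    because [U] lies in the ideal [V i.+1] of [V i]. *)
Lemma iter_mulv_chain n (V : nat -> {vspace L}) U :
    (forall i, (i <= n)%N -> (U <= V i)%VS) ->
    (forall i, (i < n)%N -> ideal_of mul (V i) (V i.+1)) ->
  (iter n (mulv mul U) (V 0%N) <= V n)%VS.
Proof.
elim: n => //= n IHn sUV idV.
have [|_ _ VV] := idV n; first exact: ltnSn.
apply: subv_trans (mulvS _ (IHn _ _)) VV => [|i /leqW|i /leqW].
- exact: sUV.
- exact: sUV.
- exact: idV.
Qed.

Hypothesis leib : left_leibniz mul.

(** Induction through [(up)w = u(pw) - p(uw)], a form of the Leibniz identity:
    the element [p] contributes [k+1] left multiplications by [U] in either
    term, and [u] one more, outside or inside.  The second term applies the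
    induction hypothesis to [U W], whence the quantification over [W]. *)
Lemma mulv_iter_mulv k U W :
  (mulv mul (iter k (mulv mul U) U) W <= iter k.+1 (mulv mul U) W)%VS.
Proof.
elim: k W => [|k IHk] W; first exact: subvv.
apply/mulvP => q w Pq Ww; move: q Pq.
(* The condition on [q] is linear, so it is enough to check it on products. *)
suff /subvP sub : (mulv mul U (iter k (mulv mul U) U) <=
    linfun (applyr mul w) @^-1: iter k.+2 (mulv mul U) W)%VS.
  by move=> q /sub; rewrite -memv_preim lfunE.
apply/mulvP => u p Uu Pp; rewrite -memv_preim lfunE /=.
have -> : mul (mul u p) w = mul u (mul p w) - mul p (mul u w).
  by rewrite leib addrK.
apply: memvB.
  by apply: memv_mulv => //; apply: subvP (IHk W) _ _; apply: memv_mulv.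
rewrite -[mulv mul U (mulv mul U _)]/(iter k.+2 (mulv mul U) W) iterSr.
by apply: subvP (IHk _) _ _; do !apply: memv_mulv.
Qed.

Lemma mulv_derivation A B C :
  (mulv mul A (mulv mul B C) <=
     mulv mul (mulv mul A B) C + mulv mul B (mulv mul A C))%VS.
Proof.
apply/mulvP => a q Aa; move: q.
suff /subvP sub : (mulv mul B C <= linfun (mul a) @^-1:
    (mulv mul (mulv mul A B) C + mulv mul B (mulv mul A C)))%VS.
  by move=> q /sub; rewrite -memv_preim lfunE.
apply/mulvP => b c Bb Cc; rewrite -memv_preim lfunE /= leib.
by apply: memv_add; do !apply: memv_mulv.
Qed.

End Products.

Theorem theorem2p5 (F : fieldType) (L : vectType F)
  (mul : {bilinear L -> L -> L}) (leib : left_leibniz mul)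
  (U : {vspace L}) (snU : subnormal mul U) :
  ideal_of mul fullv (nilpotent_residual mul U).
Proof.
have [n [V [V0 Vn algV idV]]] := snU.
have algU : subalgebra mul U by rewrite -Vn; apply: algV.
have [k defN UN] := nilpotent_residual_stable algU.
set N := nilpotent_residual mul U in defN UN *.
have sUV i : (i <= n)%N -> (U <= V i)%VS.
  move=> lein; rewrite -Vn -(subnKC lein).
  have: (i + (n - i) <= n)%N by rewrite subnKC.
  elim: (n - i)%N => [|m IHm]; first by rewrite addn0.
  rewrite addnS => ltn; have [sVV _ _] := idV _ ltn.
  exact: subv_trans sVV (IHm (ltnW ltn)).
have sink m : (iter (m + n) (mulv mul U) fullv <= iter m (mulv mul U) U)%VS.
  rewrite iterD; apply: iter_mulvS; rewrite -V0 -[in X in (_ <= X)%VS]Vn.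
  exact: iter_mulv_chain.
split; first exact: subvf.
- have VN j : (j <= n)%N -> (mulv mul (V (n - j)%N) N <= N)%VS.
    elim: j => [_|j IHj ltjn]; first by rewrite subn0 Vn UN.
    have [] := idV (n - j.+1)%N; first by rewrite -subSn // subSS leq_subr.
    rewrite -subSn // subSS => _ VV _.
    set X := mulv mul _ N; have sX : (X <= N + mulv mul U X)%VS.
      rewrite {1}/X -{1}UN; apply: subv_trans (mulv_derivation leib _ _ _) _.
      apply: addvS => //; apply: subv_trans (IHj (ltnW ltjn)).
      apply: mulvS => //; apply: subv_trans VV.
      by apply: mulvS => //; apply/sUV/leq_subr.
    have UNs : (mulv mul U N <= N)%VS by rewrite UN.
    apply: subv_trans (sub_addv_iter_mulv (k + n) UNs sX) _.
    rewrite subv_add subvv [in X in (_ <= X)%VS]defN.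
    exact: subv_trans (iter_mulvS _ _ _ (subvf X)) (sink k).
  by have := VN n (leqnn n); rewrite subnn V0.
- (* [n] extra factors [U] are needed to descend from [L] to [U]; rewriting
     [N] as a higher power of [U] supplies them. *)
  have defNm m : N = iter (m + k) (mulv mul U) U.
    by elim: m => //= m <-; rewrite UN.
  rewrite {1}(defNm n); apply: subv_trans (mulv_iter_mulv leib _ _ _) _.
  by rewrite (defNm 1%N) addnC -addSn; apply: sink.
Qed.
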